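(* Let $\tilde\lambda>0$, let $\eta_1,\eta_2,\dots$ be i.i.d. non-negative random variables with $\mathbb{P}(\eta_1=0)=p_0$, $0\le p_0<1$, and let $\tilde N=\{\tilde N(t):t\ge 0\}$ be a homogeneous Poisson process with intensity $\tilde\lambda$, independent of $\eta_1,\eta_2,\dots$. Let $Y_1,Y_2,\dots$ be i.i.d. positive random variables with $\mathbb{P}(Y_1\le x)=\mathbb{P}(\eta_1\le x\mid \eta_1>0)$, and let $N=\{N(t):t\ge0\}$ be a homogeneous Poisson process with intensity $\tilde\lambda(1-p_0)$, independent of $Y_1,Y_2,\dots$. Then, for $x\ge 0$, $$\mathbb{P}(Y_1\le x)=\frac{\mathbb{P}(\eta_1\le x)-p_0}{1-p_0},\qquad \mathbb{E}e^{-xY_1}=\frac{\mathbb{E}e^{-x\eta_1}-p_0}{1-p_0},$$ $$\mathbb{E}Y_1=\frac{\mathbb{E}\eta_1}{1-p_0},\qquad \mathbb{D}Y_1=\frac{\mathbb{D}\eta_1}{1-p_0}-\frac{p_0(\mathbb{E}\eta_1)^2}{(1-p_0)^2}$$ (the mean and variance formulas whenever the moments involved are finite), and the processes $$\Big\{I\{\tilde N(t)>0\}\sum_{i=1}^{\tilde N(t)}\eta_i\Big\}_{t\ge0}\quad\text{and}\quad \Big\{I\{N(t)>0\}\sum_{i=1}^{N(t)}Y_i\Big\}_{t\ge 0}$$ have the same finite-dimensional distributions.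
   Context: $\mathbb{D}X$ denotes the variance of a random variable $X$, and $I\{\cdot\}$ is the indicator function. A sum multiplied by an indicator that equals $0$ is read as $0$. *)

(* Defs.v *)
From mathcomp Require Export all_boot all_order all_algebra.
From mathcomp Require Export finmap.
From mathcomp Require Export all_classical all_reals all_analysis.

Set Implicit Arguments.
Unset Strict Implicit.
Unset Printing Implicit Defensive.

Export Order.TTheory GRing.Theory Num.Theory.
Export numFieldNormedType.Exports.

Local Open Scope classical_set_scope.
Local Open Scope ring_scope.

Definition mutual_independence (d : measure_display) (T : measurableType d)
    (R : realType) (P : probability T R) (I : choiceType) (D : set I)
    (F : I -> set (set T)) : Prop :=
  forall (J : {fset I}) (E : I -> set T),
    [set` J] `<=` D -> (forall i, i \in J -> F i (E i)) ->
    P (\bigcap_(i in [set` J]) E i) = (\prod_(i <- J) P (E i))%E.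

Definition independent_systems (d : measure_display) (T : measurableType d)
    (R : realType) (P : probability T R) (F G : set (set T)) : Prop :=
  forall A B, F A -> G B -> P (A `&` B) = (P A * P B)%E.

Definition sigma_generated (d d' : measure_display) (T : measurableType d)
    (T' : measurableType d') (I : Type) (D : set I) (X : I -> T -> T') :
    set (set T) :=
  <<s \bigcup_(i in D) g_sigma_algebra_preimage (X i) >>.

(* The laws are compared on measurable sets only: the value of a measure on
   a non-measurable set carries no information. *)
Definition same_law (d1 d2 d' : measure_display) (T1 : measurableType d1)
    (T2 : measurableType d2) (T' : measurableType d') (R : realType)
    (P1 : probability T1 R) (P2 : probability T2 R)
    (X1 : T1 -> T') (X2 : T2 -> T') : Prop :=
  forall B, measurable B -> P1 (X1 @^-1` B) = P2 (X2 @^-1` B).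

Definition iid (d : measure_display) (T : measurableType d) (R : realType)
    (P : probability T R) (X : nat -> {RV P >-> R}) : Prop :=
  mutual_independence P setT (fun i => g_sigma_algebra_preimage (X i)) /\
  forall i, same_law P P (X i) (X 0%N).
Arguments iid {d T R} P X.

(* Division in [\bar R]; only meaningful when [P B] is not zero. *)
Definition cond_prob (d : measure_display) (T : measurableType d)
    (R : realType) (P : probability T R) (A B : set T) : \bar R :=
  (P (A `&` B) / P B)%E.

(* Processes are functions of all real times, but only nonnegative times matter.
   The laws of the vectors are compared for the product sigma-algebra. *)
Definition same_fdd (d1 d2 : measure_display) (T1 : measurableType d1)
    (T2 : measurableType d2) (R : realType)
    (P1 : probability T1 R) (P2 : probability T2 R)
    (X1 : R -> T1 -> R) (X2 : R -> T2 -> R) : Prop :=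
  forall (n : nat) (t : 'I_n -> R), (forall i, 0 <= t i) ->
    same_law P1 P2 (fun w => [tuple X1 (t i) w | i < n])
                   (fun w => [tuple X2 (t i) w | i < n]).

(* Real-valued, so that the subtraction is not truncated. *)
Definition increment (R : realType) (T : Type) (N : R -> T -> nat) (s t : R)
    (w : T) : R := (N t w)%:R - (N s w)%:R.

(* [s < t] is strict in [poisson_increments] because
   [poisson_pmf 0] is not the Poisson law of parameter 0. *)
Record poisson_process (d : measure_display) (T : measurableType d)
    (R : realType) (P : probability T R) (lambda : R)
    (N : R -> {RV P >-> nat}) : Prop := PoissonProcess {
  poisson_start : {ae P, forall w, N 0 w = 0%N} ;
  poisson_paths : {ae P, forall w,
    (forall s t, 0 <= s -> s <= t -> (N s w <= N t w)%N) /\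
    (forall t, 0 <= t -> (N s w)%:R @[s --> t^'+] --> ((N t w)%:R : R))} ;
  poisson_indep_increments : forall (n : nat) (t : nat -> R), 0 <= t 0%N ->
    (forall i, (i < n)%N -> t i < t i.+1) ->
    mutual_independence P `I_n
      (fun i => g_sigma_algebra_preimage (increment N (t i) (t i.+1))) ;
  poisson_increments : forall (s t : R) (k : nat), 0 <= s -> s < t ->
    P [set w | increment N s t w = k%:R] =
      (poisson_pmf (lambda * (t - s)) k)%:E
}.
Arguments poisson_process {d T R} P lambda N.

(* [X i] stands for the summand of index i + 1. *)
Definition compound_process (R : realType) (T : Type) (N : R -> T -> nat)
    (X : nat -> T -> R) (t : R) (w : T) : R :=
  (0 < N t w)%N%:R * \sum_(i < N t w) X i w.

(* Main.v *)
(** The law of eta is the mixture p0 delta_0 + (1 - p0) law(Y); this gives the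
    cdf, Laplace transform and moments at once.

    For the processes, fix a grid 0 = s_0 < ... < s_m containing all the times.
    Conditionally on the numbers of jumps in the grid cells, the vector of
    values is a walk whose steps in cell j apply the transition operator
    J_j h (v) = E h(v + eta e_j), with e_j the indicator of the coordinates
    whose time lies beyond cell j, so the probability of a Borel set B is the
    composition over j of the Poisson semigroups
    G_j = sum_k Poi(lambda (s_{j+1} - s_j))(k) J_j^k, applied to the indicator
    of B. The mixture reads J_j = p0 id + (1 - p0) J'_j, with J'_j the operator
    of Y; expanding J_j^k by the binomial formula and thinning the Poisson
    weights turns G_j into the semigroup of Y with intensity
    lambda (1 - p0). *)

From HB Require Import structures.
Require Import Defs.
From mathcomp Require Import measurable_realfun.
From mathcomp Require Import ring.

Local Open Scope classical_set_scope.
Local Open Scope ring_scope.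

Set Implicit Arguments.
Unset Strict Implicit.
Unset Printing Implicit Defensive.

(** * The law of Y *)

(** Splitting [x < X] over [X = 0] and [0 < X] yields the atom and the conditional part. Open
    half-lines suffice, being a generating pi-system. *)
Lemma conditional_law_itv (R : realType) (p0 : R)
    (d : measure_display) (T : measurableType d) (P : probability T R)
    (d' : measure_display) (T' : measurableType d') (P' : probability T' R)
    (X : {RV P >-> R}) (Y : {RV P' >-> R}) :
  (forall w, 0 <= X w) -> p0 < 1 -> P [set w | X w = 0] = p0%:E ->
  (forall x : R, P' [set w | Y w <= x] =
     cond_prob P [set w | X w <= x] [set w | 0 < X w]) ->
  forall x, P [set w | x < X w] =
    (p0%:E * \d_(0%R : R) [set` `]x, +oo[] + (1 - p0)%:E * P' [set w | (x < Y w)%R])%E.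
Proof.
move=> X_ge0 p0_lt1 X0 Y_law x.
have mX (b : itv_bound R) (c : itv_bound R) :
    measurable (X @^-1` [set` Interval b c]).
  by rewrite -[X in measurable X]setTI; exact: measurable_funPT.
have mY (b : itv_bound R) (c : itv_bound R) :
    measurable (Y @^-1` [set` Interval b c]).
  by rewrite -[X in measurable X]setTI; exact: measurable_funPT.
have Xgt y : [set w | y < X w] = X @^-1` [set` `]y, +oo[].
  by apply/seteqP; split => w /=; rewrite in_itv /= andbT.
have Xle y : [set w | X w <= y] = X @^-1` [set` `]-oo, y]].
  by apply/seteqP; split => w /=; rewrite in_itv.
have Xeq : [set w | X w = 0] = X @^-1` [set` `[0, 0]].
  apply/seteqP; split => w /=; rewrite in_itv /= -eq_le; first by move=> ->.
  by move=> /eqP.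
have mgt y : measurable [set w | y < X w] by rewrite Xgt.
have mle y : measurable [set w | X w <= y] by rewrite Xle.
have m0 : measurable [set w | X w = 0] by rewrite Xeq.
have Ygt : P' [set w | x < Y w] = (1 - P' [set w | (Y w <= x)%R])%E.
  rewrite -probability_setC.
    by congr (P' _); apply/seteqP; split => w /=; rewrite ltNge => /negP.
  by rewrite (_ : [set w | _] = Y @^-1` [set` `]-oo, x]]).
have Ppos : P [set w | 0 < X w] = (1 - p0)%:E.
  rewrite EFinB -X0 -probability_setC //; congr (P _); apply/seteqP.
  by split => w /=; rewrite lt_neqAle X_ge0 andbT eq_sym => /eqP.
have q_gt0 : 0 < 1 - p0 by rewrite subr_gt0.
(* The factor [1 - p0] cancels the denominator of [cond_prob]. *)
have -> : ((1 - p0)%:E * P' [set w | (x < Y w)%R] =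
    P ([set w | (x < X w)%R] `&` [set w | (0 < X w)%R]))%E.
  rewrite Ygt Y_law /cond_prob Ppos.
  have -> : P ([set w | (x < X w)%R] `&` [set w | (0 < X w)%R]) =
      (P [set w | (0 < X w)%R] - P ([set w | (X w <= x)%R] `&` [set w | (0 < X w)%R]))%E.
    rewrite [X in (_ - P X)%E]setIC -measureD // -?ge0_fin_numE ?fin_num_measure //.
    congr (P _); apply/seteqP; split => w /= [].
      by move=> xX X0w; split => //; apply/negP; rewrite -ltNge.
    by move=> X0w /negP; rewrite -ltNge.
  rewrite Ppos.
  have : P ([set w | X w <= x] `&` [set w | 0 < X w]) \is a fin_num.
    by apply: fin_num_measure; exact: measurableI.
  case: (P (_ `&` _)) => // r _.
  rewrite inver gt_eqF //= -EFinD -EFinM -EFinD; congr EFin.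
  by rewrite mulrBr mulr1 mulrCA mulfV ?mulr1 // gt_eqF.
(* For x < 0 the event [X = 0] lies inside [x < X]; for x >= 0 both sides vanish. *)
have -> : (p0%:E * \d_(0%R : R) [set` `]x, +oo[] =
    P ([set w | (x < X w)%R] `&` [set w | X w = 0%R]))%E.
  rewrite diracE mem_setE in_itv /= andbT; have [x0|x0] := ltP x 0.
    rewrite mule1 -X0; congr (P _); apply/seteqP; split => w /=; last by case.
    by move=> ->.
  rewrite mule0 -(measure0 P); congr (P _); apply/seteqP; split => w //= -[].
  by move=> /[swap] -> /lt_geF; rewrite x0.
rewrite -measureU; [|exact: measurableI|exact: measurableI|]; last first.
  by apply/seteqP; split => w //= [[_ ->]] [_]; rewrite ltxx.
congr (P _); apply/seteqP; split => w /=; last by case => -[].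
by move=> xX; have := X_ge0 w; rewrite le_eqVlt => /predU1P[/esym Xw|Xw]; [left|right].
Qed.

(** The two laws agree on open half-lines, hence on all Borel sets. Stated for nonnegative [f], one
    identity serves the distribution function, the Laplace transform, the moments and the jump
    operators. *)
Lemma conditional_law_mixture (R : realType) (p0 : R)
    (d : measure_display) (T : measurableType d) (P : probability T R)
    (d' : measure_display) (T' : measurableType d') (P' : probability T' R)
    (X : {RV P >-> R}) (Y : {RV P' >-> R}) :
  (forall w, 0 <= X w) -> 0 <= p0 -> p0 < 1 -> P [set w | X w = 0] = p0%:E ->
  (forall x : R, P' [set w | Y w <= x] =
     cond_prob P [set w | X w <= x] [set w | 0 < X w]) ->
  forall f : R -> \bar R, measurable_fun setT f -> (forall x, 0 <= f x)%E ->
  (\int[P]_w f (X w) = p0%:E * f 0%R + (1 - p0)%:E * \int[P']_w f (Y w))%E.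
Proof.
move=> X_ge0 p0_ge0 p0_lt1 X0 Y_law f mf f0.
have q_ge0 : 0 <= 1 - p0 by rewrite subr_ge0 ltW.
pose m2 : measure _ R := measure_add (mscale (NngNum p0_ge0) (dirac (0 : R)))
  (mscale (NngNum q_ge0) (distribution P' Y)).
have mixE B : measurable B -> distribution P X B = m2 B.
  have gtE y : `]y, +oo[%classic = [set z : R | y < z].
    by apply/seteqP; split => w /=; rewrite in_itv /= andbT.
  apply: (measure_unique (@RGenOInfty.G R) (fun k => `]- k%:R, +oo[%classic)).
  - exact: (RGenOInfty.measurableE R).
  - move=> _ _ [x ->] [y ->]; exists (Num.max x y); rewrite !gtE.
    by apply/seteqP; split => z /=; rewrite gt_max; [case=> -> ->|move/andP].
  - by move=> k; eexists; reflexivity.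
  - apply/seteqP; split => // x _; exists (Num.bound `|x|) => //=.
    rewrite in_itv /= andbT ltrNl; apply: le_lt_trans (archi_boundP (normr_ge0 x)).
    by rewrite -normrN ler_norm.
  - move=> _ [x ->]; rewrite [RHS]measure_addE.
    rewrite [LHS](_ : _ = P [set w | x < X w]); last by rewrite gtE.
    rewrite (conditional_law_itv X_ge0 p0_lt1 X0 Y_law).
    by congr (_ + _ * _)%E; rewrite gtE.
  - by move=> k; rewrite -ge0_fin_numE // fin_num_measure.
have -> : (\int[P]_w f (X w) = \int[distribution P X]_x f x)%E.
  by rewrite ge0_integral_distribution.
rewrite (eq_measure_integral m2); last by move=> B mB _; exact: mixE.
rewrite ge0_integral_measure_add // !ge0_integral_mscale //.
by rewrite integral_dirac // diracT mul1e ge0_integral_distribution.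
Qed.

(** Infinite [b] is covered: multiplying or dividing by q > 0 fixes both infinities. *)
Lemma mixture_solve (R : realType) (p q : R) (a b : \bar R) : 0 < q ->
  (a = p%:E + q%:E * b)%E -> (b = (a - p%:E) / q%:E)%E.
Proof.
move=> q0 ->; rewrite inver gt_eqF //; case: b => [b| |] /=.
- congr EFin.
  by rewrite addrAC subrr add0r mulrAC mulfV ?mul1r // gt_eqF.
- by rewrite gt0_muley ?lte_fin //= gt0_mulye // lte_fin invr_gt0.
- by rewrite gt0_muleNy ?lte_fin //= gt0_mulNye // lte_fin invr_gt0.
Qed.

Lemma integrable_sqr_Lfun2 d (T : measurableType d) (R : realType)
    (mu : measure T R) (f : T -> R) : measurable_fun setT f ->
  (\int[mu]_w ((f w) ^+ 2)%:E < +oo)%E -> f \in Lfun mu 2%:E.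
Proof.
move=> mf f2; rewrite inE; apply/andP; split; rewrite inE //=.
rewrite /finite_norm unlock poweR_lty //.
apply: le_lt_trans f2; rewrite le_eqVlt; apply/predU1P; left.
by apply: eq_integral => w _; rewrite /= powR_mulrn // real_normK ?num_real.
Qed.

Section conditional_moments.
Variables (R : realType) (p0 : R).
Variables (d : measure_display) (T : measurableType d) (P : probability T R).
Variables (d' : measure_display) (T' : measurableType d') (P' : probability T' R).
Variables (X : {RV P >-> R}) (Y : {RV P' >-> R}).
Hypotheses (X_ge0 : forall w, 0 <= X w) (Y_ge0 : forall w, 0 <= Y w).
Hypotheses (p0_ge0 : 0 <= p0) (p0_lt1 : p0 < 1).
Hypothesis X0 : P [set w | X w = 0] = p0%:E.
Hypothesis Y_law : forall x : R, P' [set w | Y w <= x] =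
  cond_prob P [set w | X w <= x] [set w | 0 < X w].

Let mixture := conditional_law_mixture X_ge0 p0_ge0 p0_lt1 X0 Y_law.
Let q_gt0 : 0 < 1 - p0. Proof. by rewrite subr_gt0. Qed.

(** On the half-line where [X] and [Y] live, [f] agrees with its positive part, to which the mixture
    identity applies. This admits [f = id]. *)
Lemma conditional_expectation (f : R -> R) : measurable_fun setT f ->
  (forall x, 0 <= x -> 0 <= f x) ->
  ('E_P[fun w => f (X w)] =
     (p0 * f 0)%:E + (1 - p0)%:E * 'E_P'[fun w => f (Y w)])%E.
Proof.
move=> mf f0; rewrite unlock; pose g x := (Num.max (f x) 0)%:E.
have gE x : 0 <= x -> (f x)%:E = g x by move=> x0; rewrite /g max_l ?f0.
under eq_integral do rewrite gE //.
under [in RHS]eq_integral do rewrite gE //.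
rewrite (mixture (f := g)) ?EFinM ?gE //.
  by apply/measurable_EFinP; exact: measurable_maxr.
by move=> x; rewrite /g lee_fin le_max lexx orbT.
Qed.

(** The mixture identity for the indicator of a half-line; as 0 <= x it contains the atom, which
    contributes exactly [p0]. *)
Lemma conditional_cdf (x : R) : 0 <= x ->
  (P' [set w | (Y w <= x)%R] = (P [set w | (X w <= x)%R] - p0%:E) / (1 - p0)%:E)%E.
Proof.
move=> x0; apply: mixture_solve => //.
have mle : measurable [set z : R | z <= x].
  by rewrite (_ : mkset _ = [set` `]-oo, x]]).
have mA d1 (T1 : measurableType d1) (P1 : probability T1 R) (Z : {RV P1 >-> R}) :
    P1 [set w | Z w <= x] = (\int[P1]_w (\1_[set z : R | z <= x] (Z w))%:E)%E.
  rewrite -[in LHS](setIT [set w | _]) -integral_indic //.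
  rewrite -[X in measurable X]setTI.
  exact: (measurable_funPT Z measurableT [set z : R | z <= x] mle).
rewrite !mA (mixture (f := fun z => (\1_[set z : R | z <= x] z)%:E)) //.
  by rewrite indicE mem_set // mule1.
by apply/measurable_EFinP; exact: measurable_indic.
Qed.

Lemma conditional_laplace (x : R) :
  ('E_P'[fun w => expR (- x * Y w)] =
        ('E_P[fun w => expR (- x * X w)] - p0%:E) / (1 - p0)%:E)%E.
Proof.
apply: mixture_solve => //.
rewrite (conditional_expectation (f := fun z => expR (- x * z))).
- by rewrite mulr0 expR0 mulr1.
- by apply: measurableT_comp => //; exact: measurable_funM.
- by move=> z _; exact: expR_ge0.
Qed.

Lemma conditional_mean : ('E_P'[Y] = 'E_P[X] / (1 - p0)%:E)%E.
Proof.
rewrite -[('E_P[X])%E]sube0; apply: mixture_solve => //.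
by rewrite (conditional_expectation (f := id)) // mulr0.
Qed.

(** The atom at 0 adds nothing to the first two moments, so both scale by [1 - p0]; the correction
    term comes from squaring the mean. *)
Lemma conditional_variance : (X : T -> R) \in Lfun P 2%:E ->
  (variance P' Y =
     variance P X / (1 - p0)%:E - p0%:E * 'E_P[X] ^+ 2 / ((1 - p0) ^+ 2)%:E)%E.
Proof.
move=> X2; have X1 := Lfun_subset12 (fin_num_measure P _ measurableT) X2.
have sqrE : ('E_P[X ^+ 2] = (1 - p0)%:E * 'E_P'[Y ^+ 2])%E.
  rewrite (conditional_expectation (f := fun z => z ^+ 2)).
  - by rewrite expr0n mulr0 add0e.
  - exact: exprn_measurable.
  - by move=> z _; exact: sqr_ge0.
have EX2 : ('E_P[X ^+ 2])%E \is a fin_num.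
  by apply: expectation_fin_num; apply: Lfun2_mul_Lfun1.
(* Since [1 - p0] is positive, an infinite second moment of [Y] would make that of [X] infinite. *)
have EY2 : ('E_P'[Y ^+ 2])%E \is a fin_num.
  move: EX2; rewrite sqrE; case: ('E_P'[_])%E => //.
    by rewrite gt0_muley ?lte_fin.
  by rewrite gt0_muleNy ?lte_fin.
have Y2 : (Y : T' -> R) \in Lfun P' 2%:E.
  apply: integrable_sqr_Lfun2; first exact: measurable_funPT.
  by move: EY2; rewrite unlock => /fin_numPlt/andP[].
rewrite !varianceE // sqrE conditional_mean.
move: EY2 (expectation_fin_num X1).
case: ('E_P'[_])%E => // s _; case: ('E_P[X])%E => // m _.
rewrite inver gt_eqF // inver gt_eqF ?exprn_gt0 //; congr EFin.
have q0 : 1 - p0 != 0 by rewrite gt_eqF.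
by field.
Qed.

End conditional_moments.

(** * Walks driven by independent steps *)

Lemma measure_eq_on_rectangles d1 d2 (T1 : measurableType d1)
    (T2 : measurableType d2) (R : realType)
    (m1 m2 : {measure set (T1 * T2) -> \bar R}) :
  (m1 setT < +oo)%E ->
  (forall A B, measurable A -> measurable B -> m1 (A `*` B) = m2 (A `*` B)) ->
  forall C, measurable C -> m1 C = m2 C.
Proof.
move=> m1_fin m12.
apply: (measure_unique [set A `*` B | A in measurable & B in measurable]
  (fun=> setT)) => //.
- exact: measurable_prod_measurableType.
- move=> _ _ [A mA [B mB <-]] [A' mA' [B' mB' <-]]; rewrite -setXI.
  by exists (A `&` A'); [exact: measurableI|exists (B `&` B'); [exact: measurableI|]].
- by move=> _; exists setT => //; exists setT => //; rewrite setXTT.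
- by apply/seteqP; split => // x _; exists 0%N.
- by move=> _ [A mA [B mB <-]]; exact: m12.
Qed.

Section independent_pair.
Variables (R : realType) (d d1 d2 : measure_display) (T : measurableType d).
Variables (T1 : measurableType d1) (T2 : measurableType d2).
Variables (P : probability T R) (V : {mfun T >-> T1}) (X : {mfun T >-> T2}).

(** The joint law equals the product of the marginals on rectangles, hence everywhere; Tonelli then
    separates the integrals. *)
Lemma independent_pair_integral :
  (forall A B, measurable A -> measurable B ->
     P (V @^-1` A `&` X @^-1` B) = (P (V @^-1` A) * P (X @^-1` B))%E) ->
  forall f : T1 * T2 -> \bar R, measurable_fun setT f -> (forall z, 0 <= f z)%E ->
  (\int[P]_w f (V w, X w) = \int[P]_w \int[P]_w' f (V w, X w'))%E.
Proof.
move=> indep f mf f0.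
have mVX : measurable_fun setT (fun w => (V w, X w)) by exact: measurable_fun_pair.
transitivity (\int[distribution P V \x distribution P X]_z f z)%E.
  rewrite (@eq_measure_integral _ _ _ setT
     (pushforward P (fun w => (V w, X w)) : {measure set (T1 * T2) -> \bar R})).
    by rewrite ge0_integral_pushforward.
  move=> C mC _; apply: product_measure_unique mC => A B mA mB.
  by rewrite -indep.
rewrite fubini_tonelli1 // ge0_integral_distribution //; last 2 first.
- exact: measurable_fun_fubini_tonelli_F.
- by move=> x; apply: integral_ge0.
apply: eq_integral => w _; rewrite /= /fubini_F ge0_integral_distribution //.
exact: measurable_fun_pair2.
Qed.

End independent_pair.

Section walk.
Variables (R : realType) (d dE : measure_display).
Variables (T : measurableType d) (E : measurableType dE).
Variables (I : Type) (act : I -> E -> R -> E).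
Hypothesis mact : forall i, measurable_fun setT (fun z : E * R => act i z.1 z.2).
Variable P : probability T R.

(** The transition operator of one step of type [i] with size distributed as [Z]. Values in [\bar R]
    allow iteration on nonnegative measurable functions without integrability conditions. *)
Definition jump (Z : T -> R) (i : I) (h : E -> \bar R) (v : E) : \bar R :=
  (\int[P]_w h (act i v (Z w)))%E.

Lemma jump_ge0 Z i h : (forall v, 0 <= h v)%E -> forall v, (0 <= jump Z i h v)%E.
Proof. by move=> h0 v; exact: integral_ge0. Qed.

Lemma measurable_jump (Z : {mfun T >-> R}) i h :
  measurable_fun setT h -> (forall v, 0 <= h v)%E ->
  measurable_fun setT (jump Z i h).
Proof.
move=> mh h0; apply: (measurable_fun_fubini_tonelli_F (m2 := P)
  (fun z : E * T => h (act i z.1 (Z z.2)))) => //.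
apply: measurableT_comp => //.
apply: (measurableT_comp (mact i) (g := fun z : E * T => (z.1, Z z.2))).
apply: measurable_fun_pair => //; exact: measurableT_comp.
Qed.

Variable X : nat -> {mfun T >-> R}.

(** The step types [u] are fixed in advance; only the sizes [X] are random. In the application the
    type of a step is the grid cell of the jump. *)
Fixpoint walk (u : nat -> I) (v0 : E) (k : nat) (w : T) : E :=
  if k is k'.+1 then act (u k') (walk u v0 k' w) (X k' w) else v0.

(* The map [f] will be the identity from [T] with a sub-sigma-algebra, whence
   measurability with respect to the sigma-algebra generated by the steps. *)
Lemma measurable_walk u v0 k d0 (T0 : measurableType d0) (f : T0 -> T) :
  (forall i, measurable_fun setT (X i \o f)) ->
  measurable_fun setT (walk u v0 k \o f).
Proof.
move=> mX; elim: k => [|k IH] //=; first exact: measurable_cst.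
apply: (measurableT_comp (mact (u k))
  (g := fun z => ((walk u v0 k \o f) z, (X k \o f) z))).
exact: measurable_fun_pair.
Qed.

Hypothesis X_iid : iid P X.

Lemma iid_bigcap (J : {fset nat}) (B : nat -> set R) :
  (forall i, measurable (B i)) ->
  P (\bigcap_(i in [set` J]) X i @^-1` B i) = (\prod_(i <- J) P (X i @^-1` B i))%E.
Proof.
move=> mB; case: X_iid => + _; apply => // i _.
by exists (B i) => //; rewrite setTI.
Qed.

(** Induction on [k], with [J] arbitrary so that the index [k] can be added to it. The next position
    is a function of the current one and of [X k]; restricting their joint law to an event about
    later steps only scales it. *)
Lemma walk_indep u v0 k (J : {fset nat}) (B : nat -> set R) A :
  measurable A -> (forall i, i \in J -> (k <= i)%N) ->
  (forall i, measurable (B i)) ->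
  P (walk u v0 k @^-1` A `&` \bigcap_(i in [set` J]) X i @^-1` B i) =
  (P (walk u v0 k @^-1` A) * P (\bigcap_(i in [set` J]) X i @^-1` B i))%E.
Proof.
move=> mA kJ mB; elim: k J A B mA kJ mB => [|k IH] J A B mA kJ mB.
  rewrite [walk u v0 0 @^-1` A](_ : _ = cst v0 @^-1` A) // preimage_cst.
  case: ifPn => _; first by rewrite setTI probability_setT mul1e.
  by rewrite set0I measure0 mul0e.
set O := \bigcap_(i in _) _.
have mX i C : measurable C -> measurable (X i @^-1` C).
  by move=> mC; rewrite -[X in measurable X]setTI; exact: measurable_funPT.
have mO : measurable O by apply: fin_bigcap_measurable => // i _; exact: mX.
have mV : measurable_fun setT (walk u v0 k).
  by apply: (measurable_walk u v0 k (f := id)) => i; exact: measurable_funPT.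
have mVX : measurable_fun setT (fun w => (walk u v0 k w, X k w)).
  by exact: measurable_fun_pair.
have k_notin : k \notin J by apply/negP => /kJ; rewrite ltnn.
(* The constraint on [X k] joins the family [D] at index [k], and the induction hypothesis is
   applied to [L] enlarged by [k]. *)
have rect A1 B1 (D : nat -> set R) (L : {fset nat}) : measurable A1 -> measurable B1 ->
    k \notin L -> (forall i, i \in L -> (k <= i)%N) -> (forall i, measurable (D i)) ->
    P (walk u v0 k @^-1` A1 `&` X k @^-1` B1 `&` \bigcap_(i in [set` L]) X i @^-1` D i) =
    (P (walk u v0 k @^-1` A1) * P (X k @^-1` B1) *
      P (\bigcap_(i in [set` L]) X i @^-1` D i))%E.
  move=> mA1 mB1 kL Lk mD.
  pose D' i := if i == k then B1 else D i.
  have D'L i : i \in L -> D' i = D i.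
    by rewrite /D'; case: eqP => // -> ; rewrite (negPf kL).
  have capE : X k @^-1` B1 `&` \bigcap_(i in [set` L]) X i @^-1` D i =
      \bigcap_(i in [set` (k |` L)%fset]) X i @^-1` D' i.
    apply/seteqP; split => w /=.
      move=> [Xk wL] i /=; rewrite !inE /D' => /predU1P[->|iL]; first by rewrite eqxx.
      by case: eqP => [->//|_]; exact: wL.
    move=> wL; split.
      by have := wL k; rewrite /= !inE eqxx /D' eqxx; exact.
    by move=> i /= iL; have := wL i; rewrite /= !inE iL orbT D'L //; exact.
  have mD' i : measurable (D' i) by rewrite /D'; case: ifP.
  rewrite -setIA capE IH //; last first.
    by move=> i; rewrite !inE => /predU1P[->//|]; exact: Lk.
  rewrite -muleA; congr (_ * _)%E; rewrite !iid_bigcap // big_fsetU1 //=.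
  rewrite /D' eqxx; congr (_ * _)%E; rewrite big_seq [RHS]big_seq.
  by apply: eq_bigr => i iL; rewrite -/(D' i) D'L.
have pairE A1 B1 : measurable A1 -> measurable B1 ->
    P (walk u v0 k @^-1` A1 `&` X k @^-1` B1) =
    (P (walk u v0 k @^-1` A1) * P (X k @^-1` B1))%E.
  move=> mA1 mB1; have := rect A1 B1 B fset0 mA1 mB1.
  by rewrite set_fset0 bigcap_set0 setIT probability_setT mule1; apply.
have POE : (fine (P O))%:E = P O by rewrite fineK // fin_num_measure.
(* [m1] is the law of position and step on the event [O], [m2] their full law times the probability
   of [O]. They agree on rectangles, hence on the set sent into [A] by the action. *)
pose m1 : {measure set (E * R) -> \bar R} :=
  pushforward (mrestr P mO) (fun w => (walk u v0 k w, X k w)).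
pose m2 : {measure set (E * R) -> \bar R} :=
  mscale (NngNum (fine_ge0 (measure_ge0 P O)))
    (pushforward P (fun w => (walk u v0 k w, X k w))).
have := @measure_eq_on_rectangles _ _ E R R (m1 mVX) (m2 mVX) _ _
  ((fun z : E * R => act (u k) z.1 z.2) @^-1` A).
rewrite muleC -POE; apply.
- rewrite -ge0_fin_numE //; apply: fin_num_measure.
  by rewrite preimage_setT.
- move=> A1 B1 mA1 mB1.
  transitivity (P (walk u v0 k @^-1` A1 `&` X k @^-1` B1 `&` O)) => //.
  rewrite rect //; last by move=> i /kJ /ltnW.
  rewrite -pairE // muleC -[in LHS]POE //.
- by rewrite -[X in measurable X]setTI; exact: mact.
Qed.

(** Induction peels off the last step: being independent of the current position, it replaces [h] by
    its image under [jump]. The operator of the first step ends up outermost. *)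
Lemma expectation_walk u v0 k h : measurable_fun setT h -> (forall v, 0 <= h v)%E ->
  (\int[P]_w h (walk u v0 k w) = foldr (jump (X 0%N)) h (mkseq u k) v0)%E.
Proof.
elim: k h => [|k IH] h mh h0.
  rewrite /= integral_cst //. rewrite -[RHS]mule1; congr (_ * _)%E.
  exact: (probability_setT P).
have mV : measurable_fun setT (walk u v0 k).
  by apply: (measurable_walk u v0 k (f := id)) => i; exact: measurable_funPT.
pose V : {mfun T >-> E} := HB.pack (walk u v0 k) (isMeasurableFun.Build _ _ _ _ _ mV).
rewrite mkseqS -cats1 foldr_cat /= -IH; last 2 first.
- exact: measurable_jump.
- exact: jump_ge0.
rewrite (@independent_pair_integral _ _ _ _ _ _ _ P V (X k) _
  (fun z => h (act (u k) z.1 z.2))) //.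
- apply: eq_integral => w _; rewrite /= /jump.
  pose g y := h (act (u k) (walk u v0 k w) y).
  have mg : measurable_fun setT g.
    apply: (measurable_fun_pair2 (f := fun z => h (act (u k) z.1 z.2))).
    exact: measurableT_comp (mact (u k)).
  have g0 y : (0 <= g y)%E by exact: h0.
  rewrite -[LHS](ge0_integral_distribution (X k) mg g0).
  rewrite -[RHS](ge0_integral_distribution (X 0%N) mg g0).
  apply: eq_measure_integral => B mB _.
  by case: X_iid => _; exact.
- move=> A B mA mB.
  have := @walk_indep u v0 k [fset k]%fset (fun=> B) A mA.
  rewrite set_fset1 bigcap_set1; apply => // i.
  by rewrite !inE => /eqP ->.
- by apply: measurableT_comp => //; exact: mact.
Qed.

End walk.

(** * Poisson semigroups and thinning *)

Lemma ge0_nneseriesZr (R : realType) (a : nat -> R) (x : \bar R) :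
  (forall k, 0 <= a k) -> (0 <= x)%E ->
  (\sum_(0 <= k <oo) (a k)%:E * x = (\sum_(0 <= k <oo) (a k)%:E) * x)%E.
Proof.
move=> a0 x0; have aE0 k : (0 <= (a k)%:E)%E by rewrite lee_fin.
rewrite -!ge0_integral_count //; last by move=> k; exact: mule_ge0.
by rewrite muleC -ge0_integralZl //; apply: eq_integral => k _; rewrite muleC.
Qed.

(** Keeping each of a Poisson number of points with probability 1 - p leaves a Poisson number. With
    k = i + j a term is the target weight times e^(-cp) (cp)^i / i!, and the exponential series sums
    to e^(cp). *)
Lemma poisson_thinning (R : realType) (p c : R) (j : nat) :
  0 <= p -> p < 1 -> 0 < c ->
  (\sum_(0 <= k <oo)
     (poisson_pmf c k * ('C(k, j)%:R * p ^+ (k - j) * (1 - p) ^+ j))%:E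
   = (poisson_pmf (c * (1 - p)) j)%:E)%E.
Proof.
move=> p0 p1 c0; have q0 : 0 < 1 - p by rewrite subr_gt0.
have t0 k : (0 <= (poisson_pmf c k * ('C(k, j)%:R * p ^+ (k - j) * (1 - p) ^+ j))%:E)%E.
  by rewrite lee_fin !mulr_ge0 ?poisson_pmf_ge0 ?exprn_ge0 ?ler0n // ltW.
(* The terms with k < j vanish with the binomial coefficient. *)
rewrite (nneseries_split 0 j) // add0n big1_seq ?add0e; last first.
  by move=> k; rewrite mem_index_iota => /andP[_ kj]; rewrite bin_small // !mul0r mulr0.
rewrite -nneseries_addn //.
pose b := poisson_pmf (c * (1 - p)) j * expR (- (c * p)).
transitivity (\sum_(0 <= i <oo) (b%:E * ((c * p) ^+ i / i`!%:R)%:E))%E.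
  apply: eq_eseriesr => i _; rewrite -EFinM; congr EFin.
  rewrite /b /poisson_pmf c0 mulr_gt0 // addnK.
  have -> : - c = - (c * (1 - p)) + - (c * p) by ring.
  rewrite expRD; have := bin_fact (leq_addl i j); rewrite addnK => H.
  have -> : ((i + j)`!%:R : R) = 'C(i + j, j)%:R * (j`!%:R * i`!%:R) by rewrite -!natrM H.
  have f0 (n : nat) : (n`!%:R : R) != 0 by rewrite pnatr_eq0 -lt0n fact_gt0.
  have C0 : ('C(i + j, j)%:R : R) != 0 by rewrite pnatr_eq0 -lt0n bin_gt0 leq_addl.
  rewrite exprD !exprMn; field.
  by rewrite !f0 C0.
rewrite nneseriesZl; last by move=> i _; rewrite lee_fin divr_ge0 // exprn_ge0 // mulr_ge0 // ltW.
have -> : (\sum_(0 <= i <oo) ((c * p) ^+ i / i`!%:R)%:E = (expR (c * p))%:E)%E.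
  rewrite expRE -EFin_lim; last first.
    rewrite /pseries/=; under eq_fun do rewrite mulrC.
    exact: is_cvg_series_exp_coeff.
  apply/congr_lim/funext => n/=; rewrite /pseries/= /series/= -sumEFin//.
  by under eq_bigr do rewrite mulrC.
by rewrite -EFinM; congr EFin; rewrite /b -mulrA -expRD addNr expR0 mulr1.
Qed.

Section poissonization.
Variables (R : realType) (dE : measure_display) (E : measurableType dE).
Variables (I : Type) (act : I -> E -> R -> E).
Hypothesis mact : forall i, measurable_fun setT (fun z : E * R => act i z.1 z.2).
Variables (d : measure_display) (T : measurableType d) (P : probability T R).
Variable (Z : {mfun T >-> R}).

Local Notation J := (jump act P Z).

Lemma iter_jump_ge0 i k h : (forall v, 0 <= h v)%E ->
  forall v, (0 <= iter k (J i) h v)%E.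
Proof. by move=> h0; elim: k => //= k IH; exact: jump_ge0. Qed.

Lemma measurable_iter_jump i k h : measurable_fun setT h -> (forall v, 0 <= h v)%E ->
  measurable_fun setT (iter k (J i) h).
Proof.
by move=> mh h0; elim: k => //= k IH; apply: measurable_jump => //; exact: iter_jump_ge0.
Qed.

Lemma measurable_act i v : measurable_fun setT (fun w => act i v (Z w)).
Proof.
apply: (measurableT_comp (measurable_fun_pair2 (f := fun z => act i z.1 z.2) v (mact i))).
exact: measurable_funPT.
Qed.

Lemma jump_nneseries i (a : nat -> R) (h : nat -> E -> \bar R) :
  (forall n, measurable_fun setT (h n)) -> (forall n v, 0 <= h n v)%E ->
  (forall n, 0 <= a n) -> forall v,
  (J i (fun v => \sum_(0 <= n <oo) (a n)%:E * h n v) v =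
   \sum_(0 <= n <oo) (a n)%:E * J i (h n) v)%E.
Proof.
move=> mh h0 a0 v; rewrite /jump integral_nneseries //.
- apply: eq_eseriesr => n _; rewrite ge0_integralZl ?lee_fin //.
  by apply: measurableT_comp => //; exact: measurable_act.
- move=> n; apply: emeasurable_funM => //.
  by apply: measurableT_comp => //; exact: measurable_act.
- by move=> n w _; rewrite mule_ge0 ?lee_fin.
Qed.

Lemma iter_jump_nneseries i k (a : nat -> R) (h : nat -> E -> \bar R) :
  (forall n, measurable_fun setT (h n)) -> (forall n v, 0 <= h n v)%E ->
  (forall n, 0 <= a n) -> forall v,
  (iter k (J i) (fun v => \sum_(0 <= n <oo) (a n)%:E * h n v) v =
   \sum_(0 <= n <oo) (a n)%:E * iter k (J i) (h n) v)%E.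
Proof.
move=> mh h0 a0; elim: k => // k IH v; rewrite iterS.
rewrite (funext IH) jump_nneseries // => n.
  exact: measurable_iter_jump.
exact: iter_jump_ge0.
Qed.

(** For c > 0 this is the series of exp(c (J_i - id)): a Poisson number of steps of type [i]. *)
Definition poissonize (c : R) (i : I) (h : E -> \bar R) (v : E) : \bar R :=
  (\sum_(0 <= k <oo) (poisson_pmf c k)%:E * iter k (J i) h v)%E.

Lemma poissonize_ge0 c i h : (forall v, 0 <= h v)%E ->
  forall v, (0 <= poissonize c i h v)%E.
Proof.
move=> h0 v; apply: nneseries_ge0 => k _ _.
by rewrite mule_ge0 ?lee_fin ?poisson_pmf_ge0 ?iter_jump_ge0.
Qed.

Lemma measurable_poissonize c i h : measurable_fun setT h -> (forall v, 0 <= h v)%E ->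
  measurable_fun setT (poissonize c i h).
Proof.
move=> mh h0; apply: ge0_emeasurable_sum => [k v _ _|k _].
  by rewrite mule_ge0 ?lee_fin ?poisson_pmf_ge0 ?iter_jump_ge0.
by apply: emeasurable_funM => //; exact: measurable_iter_jump.
Qed.

End poissonization.

Section thinning.
Variables (R : realType) (dE : measure_display) (E : measurableType dE).
Variables (I : Type) (act : I -> E -> R -> E).
Hypothesis mact : forall i, measurable_fun setT (fun z : E * R => act i z.1 z.2).
Hypothesis act0 : forall i v, act i v 0 = v.
Variables (d : measure_display) (T : measurableType d) (P : probability T R).
Variables (d' : measure_display) (T' : measurableType d') (P' : probability T' R).
Variables (X : {mfun T >-> R}) (Y : {mfun T' >-> R}) (p : R).
Hypotheses (p_ge0 : 0 <= p) (p_lt1 : p < 1).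
Hypothesis mixture : forall f : R -> \bar R, measurable_fun setT f ->
  (forall x, 0 <= f x)%E ->
  (\int[P]_w f (X w) = p%:E * f 0%R + (1 - p)%:E * \int[P']_w f (Y w))%E.

(** The binomial probability that j of k steps come from the [Y] part of the mixture. It vanishes
    for j > k despite the truncated [k - j], so sums over j can be infinite series. *)
Let b k j : R := 'C(k, j)%:R * p ^+ (k - j) * (1 - p) ^+ j.

Let b_ge0 k j : 0 <= b k j.
Proof. by rewrite /b !mulr_ge0 ?exprn_ge0 ?ler0n // subr_ge0 ltW. Qed.

Let bS0 k : b k.+1 0 = p * b k 0.
Proof. by rewrite /b !bin0 !subn0 exprS; ring. Qed.

Let bSS k j : b k.+1 j.+1 = p * b k j.+1 + (1 - p) * b k j.
Proof.
(* Pascal's rule. For k <= j, [k - j] is not the successor of [k - j.+1], but the term with the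
   latter exponent has coefficient zero. *)
rewrite /b binS subSS natrD; have [jk|kj] := ltnP j k; last by rewrite bin_small // exprS; ring.
by rewrite -(subnSK jk) !exprS; ring.
Qed.

(** By [act0] a step of size 0 leaves [v] in place, so the atom acts as p times the identity. *)
Lemma jump_mixture i h v : measurable_fun setT h -> (forall v, 0 <= h v)%E ->
  (jump act P X i h v = p%:E * h v + (1 - p)%:E * jump act P' Y i h v)%E.
Proof.
move=> mh h0; rewrite /jump (mixture (f := fun y => h (act i v y))) ?act0 //.
apply: (measurable_fun_pair2 (f := fun z => h (act i z.1 z.2))).
exact: measurableT_comp (mact i).
Qed.

(** The binomial theorem for the operator p id + (1 - p) J', by induction on [k]. *)
Lemma iter_jump_mixture i k h v : measurable_fun setT h -> (forall v, 0 <= h v)%E ->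
  (iter k (jump act P X i) h v =
   \sum_(0 <= j <oo) (b k j)%:E * iter j (jump act P' Y i) h v)%E.
Proof.
move=> mh h0; set H := fun j => iter j (jump act P' Y i) h.
have H0 j u : (0 <= H j u)%E by exact: iter_jump_ge0.
have mH j : measurable_fun setT (H j) by exact: measurable_iter_jump.
have bH0 k' j u : (0 <= (b k' j)%:E * H j u)%E by rewrite mule_ge0 // lee_fin b_ge0.
have q0 : 0 <= 1 - p by rewrite subr_ge0 ltW.
have t0 q k' j u : 0 <= q -> (0 <= q%:E * ((b k' j)%:E * H j u))%E.
  by move=> ?; rewrite mule_ge0 ?lee_fin.
have t1 k' j u : (0 <= (1 - p)%:E * ((b k' j)%:E * H j.+1 u))%E.
  by rewrite !mule_ge0 ?lee_fin ?b_ge0.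
elim: k v => [|k IH] v.
  rewrite nneseries_recl //; last by move=> j _; exact: bH0.
  rewrite eseries0 ?adde0; last by move=> [] // j _ _; rewrite /b bin0n !mul0r mul0e.
  by rewrite /b bin0 !expr0 !mul1r mul1e.
rewrite iterS jump_mixture; last 2 first.
- exact: measurable_iter_jump.
- exact: iter_jump_ge0.
rewrite (funext IH) jump_nneseries //.
rewrite -!nneseriesZl; last 2 first.
- by move=> j _; rewrite mule_ge0 ?lee_fin ?b_ge0 // (H0 j.+1).
- by move=> j _; exact: bH0.
(* Term 0 comes only from the part with factor p; then term j + 1 of that part meets term j of the
   other, as in [bSS]. *)
rewrite nneseries_recl //; last by move=> j _; exact: t0.
rewrite [RHS]nneseries_recl //; last by move=> j _; exact: bH0.
rewrite -addeA; congr (_ + _)%E; first by rewrite bS0 EFinM muleA.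
rewrite -![in LHS](nneseries_addn 1) -?[in RHS](nneseries_addn 1); last 2 first.
- by move=> j; exact: bH0.
- by move=> j; exact: t0.
rewrite -nneseriesD //; last 2 first.
- by move=> j _ _; rewrite addn1; exact: t0.
- by move=> j _ _; exact: t1.
apply: eq_eseriesr => j _; rewrite addn1 bSS (EFinD (p * _)).
by rewrite ge0_muleDl ?lee_fin ?(mulr_ge0 _ (b_ge0 _ _)) // 2!(EFinM _ (b _ _)) -!muleA.
Qed.

(** After expanding every power binomially and exchanging the nonnegative series, the coefficient of
    the j-th power is the sum evaluated by [poisson_thinning]. *)
Lemma poissonize_thinning c i h v : 0 < c ->
  measurable_fun setT h -> (forall v, 0 <= h v)%E ->
  (poissonize act P X c i h v = poissonize act P' Y (c * (1 - p)) i h v)%E.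
Proof.
move=> c0 mh h0; rewrite /poissonize.
set H := fun j => iter j (jump act P' Y i) h.
have H0 j u : (0 <= H j u)%E by exact: iter_jump_ge0.
transitivity (\sum_(0 <= k <oo) \sum_(0 <= j <oo)
    ((poisson_pmf c k * b k j)%:E * H j v))%E.
  apply: eq_eseriesr => k _; rewrite iter_jump_mixture // -nneseriesZl.
    by apply: eq_eseriesr => j _; rewrite EFinM muleA.
  by move=> j _; rewrite mule_ge0 ?lee_fin ?b_ge0 // (H0 j).
rewrite nneseries_interchange; last first.
  by move=> k j; rewrite mule_ge0 ?lee_fin ?(mulr_ge0 (poisson_pmf_ge0 _ _) (b_ge0 _ _)) // (H0 j).
apply: eq_eseriesr => j _; rewrite ge0_nneseriesZr ?poisson_thinning //.
by move=> k; exact: mulr_ge0 (poisson_pmf_ge0 _ _) (b_ge0 _ _).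
Qed.

End thinning.

(** * Compositions of Poisson semigroups *)

Section iterated_sum.
Variable R : realType.

(** The sum over all [n]-tuples of naturals, nested so that properties of a single series extend by
    induction. *)
Fixpoint isum (n : nat) (phi : seq nat -> \bar R) : \bar R :=
  if n is m.+1 then (\sum_(0 <= l <oo) isum m (fun ls => phi (l :: ls)))%E
  else phi [::].

Lemma isum_ge0 n phi : (forall ls, 0 <= phi ls)%E -> (0 <= isum n phi)%E.
Proof.
elim: n phi => [|n IH] phi phi0 //=.
by apply: nneseries_ge0 => l _ _; exact: IH.
Qed.

Lemma eq_isum n phi psi : (forall ls, size ls = n -> phi ls = psi ls) ->
  isum n phi = isum n psi.
Proof.
elim: n phi psi => [|n IH] phi psi e /=; first exact: e.
by apply: eq_eseriesr => l _; apply: IH => ls ns; apply: e; rewrite /= ns.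
Qed.

Lemma isumZ n (x : R) phi : 0 <= x -> (forall ls, 0 <= phi ls)%E ->
  (isum n (fun ls => x%:E * phi ls) = x%:E * isum n phi)%E.
Proof.
move=> x0; elim: n phi => [|n IH] phi phi0 //=.
rewrite -nneseriesZl; last by move=> l _; exact: isum_ge0.
by apply: eq_eseriesr => l _; exact: IH.
Qed.

(** Total probability: [A] is partitioned by the value of one count at a time. *)
Lemma prob_isum d (T : measurableType d) (P : probability T R) (I : Type)
    (D : I -> T -> nat) (js : seq I) (A : set T) :
  (forall i k, measurable (D i @^-1` [set k])) -> measurable A ->
  P A = isum (size js) (fun ls => P (A `&` [set w | [seq D j w | j <- js] = ls])).
Proof.
move=> mD; elim: js A => [|j js IH] A mA /=.
  by congr (P _); apply/seteqP; split => w //= [].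
transitivity (\sum_(0 <= l <oo) P (A `&` D j @^-1` [set l]))%E.
  rewrite -measure_semi_bigcup.
  - by congr (P _); rewrite -setI_bigcupr -preimage_bigcup bigcup_imset1 image_id preimage_setT setIT.
  - by move=> l; exact: measurableI.
  - exact: trivIset_preimage1_in.
  - by apply: bigcup_measurable => l _; exact: measurableI.
apply: eq_eseriesr => l _; rewrite IH; last exact: measurableI.
apply: eq_isum => ls _; congr (P _); apply/seteqP; split => w /=.
  by move=> [[Aw ->] ->].
by move=> [Aw [<- <-]].
Qed.

End iterated_sum.

(** The cells of the successive jumps, when [ls] lists the numbers of jumps in the cells [js]. *)
Definition blocks (I : Type) (js : seq I) (ls : seq nat) : seq I :=
  flatten [seq nseq p.2 p.1 | p <- zip js ls].

Lemma size_blocks (ls : seq nat) a : size (blocks (iota a (size ls)) ls) = sumn ls.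
Proof.
elim: ls a => //= x ls IH a; rewrite /blocks /= size_cat size_nseq.
by rewrite -/(blocks _ _) IH.
Qed.

(** Cells are visited in increasing order, so the jumps in the first [p] cells are the initial ones.
    The offset [a] serves the induction. *)
Lemma nth_blocks_lt (ls : seq nat) a p l : (l < sumn ls)%N ->
  (nth 0 (blocks (iota a (size ls)) ls) l < a + p)%N = (l < sumn (take p ls))%N.
Proof.
elim: ls a p l => // x ls IH a p l /= lx.
rewrite /blocks /= -/(blocks _ _) nth_cat size_nseq; case: ifPn => [lt_lx|].
  rewrite nth_nseq lt_lx; case: p => [|p] /=; first by rewrite addn0 ltnn.
  by rewrite addnS ltnS leq_addr ltn_addr.
rewrite -leqNgt => le_xl.
have lx' : (l - x < sumn ls)%N by rewrite ltn_subLR.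
case: p => [|p] /=; last by rewrite addnS -addSn IH // ltn_subLR.
(* For p = 0: the remaining cells start at [a.+1], so none lies below [a]. *)
rewrite ltn0 addn0; have := IH a.+1 0 _ lx'; rewrite take0 addn0 /= => h.
by apply/negbTE; rewrite -leqNgt ltnW // ltnNge -ltnS h.
Qed.

Section poissonize_fold.
Variables (R : realType) (dE : measure_display) (E : measurableType dE).
Variables (I : Type) (act : I -> E -> R -> E).
Hypothesis mact : forall i, measurable_fun setT (fun z : E * R => act i z.1 z.2).
Variables (d : measure_display) (T : measurableType d) (P : probability T R).
Variable (Z : {mfun T >-> R}) (c : I -> R).

Local Notation J := (jump act P Z).
Local Notation G := (fun j => poissonize act P Z (c j) j).

Lemma foldr_jump_ge0 u h : (forall v, 0 <= h v)%E -> forall v, (0 <= foldr J h u v)%E.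
Proof. by move=> h0; elim: u => //= i u IH; exact: jump_ge0. Qed.

Lemma measurable_foldr_jump u h : measurable_fun setT h -> (forall v, 0 <= h v)%E ->
  measurable_fun setT (foldr J h u).
Proof.
by move=> mh h0; elim: u => //= i u IH; apply: measurable_jump => //; exact: foldr_jump_ge0.
Qed.

Lemma foldr_poissonize_ge0 js h : (forall v, 0 <= h v)%E ->
  forall v, (0 <= foldr G h js v)%E.
Proof. by move=> h0; elim: js => //= j js IH; exact: poissonize_ge0. Qed.

Lemma measurable_foldr_poissonize js h : measurable_fun setT h ->
  (forall v, 0 <= h v)%E ->
  measurable_fun setT (foldr G h js).
Proof.
move=> mh h0; elim: js => //= j js IH.
by apply: measurable_poissonize => //; exact: foldr_poissonize_ge0.
Qed.

Lemma measurable_isum n (phi : seq nat -> E -> \bar R) :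
  (forall ls, measurable_fun setT (phi ls)) -> (forall ls v, 0 <= phi ls v)%E ->
  measurable_fun setT (fun v => isum n (phi^~ v)).
Proof.
elim: n phi => [|n IH] phi mphi phi0 //=.
apply: ge0_emeasurable_sum => [l v _ _|l _]; first exact: isum_ge0.
exact: (IH (fun ls => phi (l :: ls))).
Qed.

Lemma iter_jumpZ i k (x : R) h : 0 <= x -> measurable_fun setT h ->
  (forall v, 0 <= h v)%E ->
  forall v, (iter k (J i) (fun v => x%:E * h v) v = x%:E * iter k (J i) h v)%E.
Proof.
move=> x0 mh h0; elim: k => // k IH v; rewrite !iterS (funext IH) /jump ge0_integralZl //.
- apply: measurableT_comp; first exact: measurable_iter_jump.
  exact: measurable_act.
- by move=> w _; exact: iter_jump_ge0.
Qed.

Lemma iter_jump_isum i k n (phi : seq nat -> E -> \bar R) :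
  (forall ls, measurable_fun setT (phi ls)) -> (forall ls v, 0 <= phi ls v)%E ->
  forall v, iter k (J i) (fun v => isum n (phi^~ v)) v =
    isum n (fun ls => iter k (J i) (phi ls) v).
Proof.
elim: n phi => [|n IH] phi mphi phi0 v //=.
(* The weights 1 bring the series into the form of [iter_jump_nneseries]. *)
transitivity (iter k (J i) (fun v =>
    \sum_(0 <= l <oo) 1%:E * isum n (fun ls => phi (l :: ls) v))%E v).
  by congr (iter k _ _ v); apply/funext => u; apply: eq_eseriesr => l _; rewrite mul1e.
rewrite (iter_jump_nneseries mact P Z i k (a := fun=> 1)
  (h := fun l v => isum n (fun ls => phi (l :: ls) v))) //.
- by apply: eq_eseriesr => l _; rewrite mul1e IH.
- by move=> l; exact: (@measurable_isum n (fun ls => phi (l :: ls))).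
- by move=> l u; exact: isum_ge0.
Qed.

(** Expanding all the Poisson semigroups gives a sum over the numbers of jumps per cell; the powers
    of the operators then concatenate into one word, [blocks js ls]. *)
Lemma foldr_poissonize js h : measurable_fun setT h -> (forall v, 0 <= h v)%E ->
  forall v, foldr G h js v = isum (size js) (fun ls =>
    (\prod_(p <- zip js ls) poisson_pmf (c p.1) p.2)%:E * foldr J h (blocks js ls) v)%E.
Proof.
move=> mh h0; elim: js => [|j js IH] v; first by rewrite /= big_nil mul1e.
rewrite /= /poissonize; apply: eq_eseriesr => l _.
rewrite (funext IH).
have W0 js' ls : 0 <= \prod_(p <- zip js' ls) poisson_pmf (c p.1) p.2.
  by apply: prodr_ge0 => p _; exact: poisson_pmf_ge0.
rewrite (@iter_jump_isum j l (size js) (fun ls v => (\prod_(p <- zip js ls)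
    poisson_pmf (c p.1) p.2)%:E * foldr J h (blocks js ls) v)%E); last 2 first.
- move=> ls; apply: emeasurable_funM => //; exact: measurable_foldr_jump.
- by move=> ls u; rewrite mule_ge0 ?lee_fin ?foldr_jump_ge0.
rewrite -isumZ ?poisson_pmf_ge0 //; last first.
  move=> ls; apply: iter_jump_ge0 => u.
  by rewrite mule_ge0 ?lee_fin ?foldr_jump_ge0.
apply: eq_isum => ls _; rewrite iter_jumpZ //; last 2 first.
- exact: measurable_foldr_jump.
- exact: foldr_jump_ge0.
rewrite big_cons EFinM -muleA; do 2 congr (_ * _)%E.
rewrite /blocks /= foldr_cat; congr (_ v).
by elim: l => //= l ->.
Qed.

End poissonize_fold.

(** Induction along the cells: the inner factors are replaced first, then [poissonize_thinning]
    treats the outer one. *)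
Lemma foldr_poissonize_thinning (R : realType) dE (E : measurableType dE) (I : Type)
    (act : I -> E -> R -> E)
    (mact : forall i, measurable_fun setT (fun z : E * R => act i z.1 z.2))
    (act0 : forall i v, act i v 0 = v)
    d (T : measurableType d) (P : probability T R)
    d' (T' : measurableType d') (P' : probability T' R)
    (X : {mfun T >-> R}) (Y : {mfun T' >-> R}) (p : R) (c : I -> R) :
  0 <= p -> p < 1 ->
  (forall f : R -> \bar R, measurable_fun setT f -> (forall x, 0 <= f x)%E ->
    (\int[P]_w f (X w) = p%:E * f 0%R + (1 - p)%:E * \int[P']_w f (Y w))%E) ->
  forall h, measurable_fun setT h -> (forall v, 0 <= h v)%E ->
  forall js, all (fun j => 0 < c j) js ->
  foldr (fun j => poissonize act P X (c j) j) h js =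
  foldr (fun j => poissonize act P' Y (c j * (1 - p)) j) h js.
Proof.
move=> p_ge0 p_lt1 mixture h mh h0; elim=> [//|j js IH] /andP[cj /IH e].
apply/funext => v; pose G' j := poissonize act P' Y (c j * (1 - p)) j.
have mG : measurable_fun setT (foldr G' h js).
  exact: (measurable_foldr_poissonize mact P' Y (fun j => c j * (1 - p))).
have G_ge0 : forall u, (0 <= foldr G' h js u)%E.
  exact: (foldr_poissonize_ge0 act P' Y (fun j => c j * (1 - p))).
apply: etrans (congr1 (fun g => poissonize act P X (c j) j g v) e) _.
exact: (poissonize_thinning mact act0 p_ge0 p_lt1 mixture j v cj mG G_ge0).
Qed.

(** * Finite-dimensional distributions *)

(** Turns membership in a generated sigma-algebra into ordinary measurability on
    [g_sigma_algebraType]. *)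
Lemma measurable_sigma_generated d d' (T : measurableType d) (T' : measurableType d')
    (I : Type) (D : set I) (X : I -> T -> T') i : D i ->
  measurable_fun
    (setT : set (g_sigma_algebraType (\bigcup_(i in D) g_sigma_algebra_preimage (X i))))
    (X i).
Proof.
move=> Di _ B mB; rewrite setTI; apply: sub_sigma_algebra.
by exists i => //; exists B => //; rewrite setTI.
Qed.

Lemma measurable_nat_index d d' (T : measurableType d) (T' : measurableType d')
    (N : T -> nat) (F : nat -> T -> T') :
  measurable_fun setT N -> (forall k, measurable_fun setT (F k)) ->
  measurable_fun setT (fun w => F (N w) w).
Proof.
move=> mN mF _ B mB.
rewrite (_ : _ `&` _ = \bigcup_k (N @^-1` [set k] `&` F k @^-1` B)).
  apply: bigcup_measurable => k _; apply: measurableI.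
    by rewrite -[X in measurable X]setTI; exact: mN.
  by rewrite -[X in measurable X]setTI; exact: mF.
apply/seteqP; split => w /=; first by move=> [_ ?]; exists (N w).
by move=> [k _ [/= ->]].
Qed.

Lemma probability_ae_eq d (T : measurableType d) (R : realType) (P : probability T R)
    (A B : set T) : measurable A -> measurable B ->
  {ae P, forall w, A w <-> B w} -> P A = P B.
Proof.
move=> mA mB AB; rewrite -[A]setIT -[B]setIT -!integral_indic //.
apply: ae_eq_integral => //; first exact/measurable_EFinP/measurable_indic.
  exact/measurable_EFinP/measurable_indic.
apply: filterS AB => w AB _; congr EFin; rewrite !indicE.
by congr ((nat_of_bool _)%:R); apply/idP/idP; rewrite !inE => /AB.
Qed.

Lemma measurable_map_eq d (T : measurableType d) (I : Type) (D : I -> T -> nat)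
    (js : seq I) (ls : seq nat) :
  (forall i k, measurable (D i @^-1` [set k])) ->
  measurable [set w | [seq D j w | j <- js] = ls].
Proof.
move=> mD; elim: js ls => [|j js IH] [|l ls] /=.
- by rewrite (_ : mkset _ = setT) //; apply/seteqP; split.
- by rewrite (_ : mkset _ = set0) //; apply/seteqP; split.
- by rewrite (_ : mkset _ = set0) //; apply/seteqP; split.
- rewrite (_ : mkset _ = D j @^-1` [set l] `&` [set w | [seq D j w | j <- js] = ls]).
    exact: measurableI.
  by apply/seteqP; split => w /=; [case=> -> ->|case=> -> ->].
Qed.

Section compound_act.
Variables (R : realType) (n : nat) (pos : 'I_n -> nat).

(* The time of coordinate [i] is the grid point of index [pos i], so a jump in
   the cell of index [j] contributes to it exactly when [j < pos i]. *)
Definition compound_act (j : nat) (v : n.-tuple R) (y : R) : n.-tuple R :=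
  [tuple tnth v i + (if (j < pos i)%N then y else 0) | i < n].

Lemma compound_act0 j v : compound_act j v 0 = v.
Proof.
by apply: eq_from_tnth => i; rewrite tnth_mktuple; case: ifP; rewrite addr0.
Qed.

Lemma measurable_compound_act j :
  measurable_fun setT (fun z : n.-tuple R * R => compound_act j z.1 z.2).
Proof.
apply/measurable_fun_tnthP => i.
rewrite [X in measurable_fun _ X](_ : _ = fun z : n.-tuple R * R =>
    tnth z.1 i + (if (j < pos i)%N then z.2 else 0)); last first.
  by apply/funext => z /=; rewrite tnth_mktuple.
apply: measurable_funD.
  exact: (measurableT_comp (measurable_tnth i) measurable_fst).
case: (j < pos i)%N; last exact: measurable_cst.
exact: measurable_snd.
Qed.

Lemma tnth_walk d (T : measurableType d) (X : nat -> {mfun T >-> R}) u k w i :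
  tnth (walk compound_act X u [tuple 0 | _ < n] k w) i =
  \sum_(l < k | (u l < pos i)%N) X l w.
Proof.
elim: k => [|k IH] /=; first by rewrite tnth_mktuple big_ord0.
by rewrite tnth_mktuple IH [RHS]big_mkcond big_ord_recr /= -big_mkcond.
Qed.

End compound_act.

Section compound_law.
Variables (R : realType) (d : measure_display) (T : measurableType d).
Variables (P : probability T R) (c : R).
Variables (X : nat -> {RV P >-> R}) (N : R -> {RV P >-> nat}).
Hypotheses (X_iid : iid P X) (N_poisson : poisson_process P c N).
Hypothesis N_X_indep : independent_systems P
  (sigma_generated [set t : R | 0 <= t] (fun t => N t : T -> nat))
  (sigma_generated [set: nat] (fun i => X i : T -> R)).
Variables (n m : nat) (s : nat -> R) (pos : 'I_n -> nat).
Hypotheses (s0 : s 0 = 0) (s_lt : forall j, (j < m)%N -> s j < s j.+1).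
Hypothesis pos_le : forall i, (pos i <= m)%N.

Let s_ge0 j : (j <= m)%N -> 0 <= s j.
Proof.
elim: j => [|j IH jm]; first by rewrite s0.
by apply: le_trans (IH (ltnW jm)) (ltW (s_lt jm)).
Qed.

(** Natural-valued, so that [isum] can range over its values; truncated subtraction agrees with
    [increment] where the path does not decrease. *)
Let D j w := (N (s j.+1) w - N (s j) w)%N.

(** Phrased with [increment], to which the independence of increments applies; almost surely it says
    that the counts [D] are [ls]. *)
Let pattern (ls : seq nat) : set T :=
  \bigcap_(j in [set` [fset j in iota 0 m]%fset])
    [set w | increment N (s j) (s j.+1) w = (nth 0 ls j)%:R].

Lemma measurable_increment d0 (T0 : measurableType d0) (f : T0 -> T) a b :
  measurable_fun setT (N a \o f) -> measurable_fun setT (N b \o f) ->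
  measurable_fun setT (increment N a b \o f).
Proof.
move=> ma mb; apply: measurable_funB.
  exact: (measurableT_comp (f := fun k : nat => k%:R : R)).
exact: (measurableT_comp (f := fun k : nat => k%:R : R)).
Qed.

Lemma prob_pattern ls : size ls = m ->
  P (pattern ls) =
  (\prod_(p <- zip (iota 0 m) ls) poisson_pmf (c * (s p.1.+1 - s p.1)) p.2)%:E.
Proof.
move=> sz; rewrite /pattern.
rewrite (poisson_indep_increments N_poisson (n := m) (t := s)); last 4 first.
- by rewrite s0.
- exact: s_lt.
- by move=> j /=; rewrite !inE mem_iota.
- move=> j _; exists [set (nth 0 ls j)%:R]; first exact: measurable_set1.
  by rewrite setTI.
(* Both products are rewritten over the cell indices 0, ..., m - 1. *)
have -> : zip (iota 0 m) ls = [seq (j, nth 0 ls j) | j <- iota 0 m].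
  apply: (@eq_from_nth _ (0, 0)); first by rewrite size_zip size_map size_iota sz minnn.
  move=> j; rewrite size_zip size_iota sz minnn => jm.
  by rewrite nth_zip ?size_iota // (nth_map 0) ?size_iota // nth_iota // add0n.
rewrite big_map /= -prodEFin (perm_big (iota 0 m)) /=; last first.
  by apply: uniq_perm; rewrite ?fset_uniq ?iota_uniq // => j; rewrite !inE.
rewrite big_seq [RHS]big_seq; apply: eq_bigr => j.
rewrite mem_iota /= add0n => jm.
by rewrite (poisson_increments N_poisson) // ?s_lt // s_ge0 // ltnW.
Qed.

(** The pattern depends on [N] alone and, for fixed [u] and [k], the walk depends on [X] alone. *)
Lemma prob_pattern_walk ls (B : set (n.-tuple R)) u v0 k : measurable B ->
  P (pattern ls `&` walk (compound_act pos) X u v0 k @^-1` B) =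
  (P (pattern ls) * P (walk (compound_act pos) X u v0 k @^-1` B))%E.
Proof.
move=> mB; apply: N_X_indep.
  rewrite /sigma_generated; set G := \bigcup_(i in _) _.
  change (measurable (pattern ls : set (g_sigma_algebraType G))).
  apply: fin_bigcap_measurable => // j; rewrite /= !inE mem_iota => /andP[_ jm].
  rewrite -[X in measurable X]setTI.
  have mI : measurable_fun (setT : set (g_sigma_algebraType G)) (increment N (s j) (s j.+1)).
    apply: (@measurable_increment _ (g_sigma_algebraType G) id (s j) (s j.+1)).
      apply: (@measurable_sigma_generated _ _ T nat R [set t : R | 0 <= t] N).
      by rewrite /= s_ge0 // ltnW.
    apply: (@measurable_sigma_generated _ _ T nat R [set t : R | 0 <= t] N).
    by rewrite /= s_ge0.
  exact: (mI measurableT [set (nth 0 ls j)%:R] (measurable_set1 _)).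
rewrite /sigma_generated; set G := \bigcup_(i in _) _.
have mV : measurable_fun (setT : set (g_sigma_algebraType G))
    (walk (compound_act pos) X u v0 k).
  apply: (measurable_walk (measurable_compound_act pos) (X := X) u v0 k
    (T0 := g_sigma_algebraType G) (f := id)) => // i.
  exact: (@measurable_sigma_generated _ _ T R nat setT X).
by have := mV measurableT B mB; rewrite setTI.
Qed.

Lemma measurable_compound_tuple :
  measurable_fun setT (fun w => [tuple compound_process N X (s (pos i)) w | i < n]).
Proof.
apply/measurable_fun_tnthP => i.
rewrite [X in measurable_fun _ X](_ : _ = compound_process N X (s (pos i))); last first.
  by apply/funext => w /=; rewrite tnth_mktuple.
apply: (@measurable_nat_index _ _ T R (N (s (pos i)))
  (fun k w => (0 < k)%N%:R * \sum_(l < k) X l w)) => // k.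
apply: measurable_funM => //.
by apply: measurable_sum => l.
Qed.

(** On the pattern, coordinate [i] sums as many initial jumps as the first [pos i] cells contain; by
    [nth_blocks_lt] these are the jumps that the walk adds to it. *)
Lemma compound_walk ls w : size ls = m -> N 0 w = 0 ->
  (forall a b, 0 <= a -> a <= b -> (N a w <= N b w)%N) -> pattern ls w ->
  [tuple compound_process N X (s (pos i)) w | i < n] =
  walk (compound_act pos) X (nth 0 (blocks (iota 0 m) ls)) [tuple 0 | _ < n] (sumn ls) w.
Proof.
move=> sz N0 Nmono pat; apply: eq_from_tnth => i.
(* The increments telescope from [N 0 w = 0]. *)
have NE j : (j <= m)%N -> N (s j) w = sumn (take j ls).
  elim: j => [|j IH] jm; first by rewrite s0 N0 take0.
  have : increment N (s j) (s j.+1) w = (nth 0 ls j)%:R.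
    by apply: pat; rewrite /= !inE mem_iota.
  rewrite /increment (IH (ltnW jm)) => /(canRL (subrK _)).
  rewrite -natrD => /(mulrIn (oner_neq0 R)) ->.
  by rewrite (take_nth 0) ?sz // sumn_rcons addnC.
rewrite tnth_walk tnth_mktuple /compound_process NE //.
have le_sum : (sumn (take (pos i) ls) <= sumn ls)%N.
  by rewrite -[in leqRHS](cat_take_drop (pos i) ls) sumn_cat leq_addr.
under [RHS]eq_bigl do rewrite -[pos i]add0n -{1}sz nth_blocks_lt //.
rewrite -(big_ord_widen _ (fun l => X l w)) //.
(* Without jumps both sides are 0; otherwise the indicator is 1. *)
by case: (sumn _) => [|k]; rewrite ?big_ord0 ?mulr0 ?mul1r.
Qed.

(** Both sides are sums over the jump counts [ls]. Termwise, the Poisson weights are the probability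
    of the pattern and the operators that of the walk lying in [B]; independence merges the two. *)
Lemma compound_tuple_law (B : set (n.-tuple R)) : measurable B ->
  P ((fun w => [tuple compound_process N X (s (pos i)) w | i < n]) @^-1` B) =
  foldr (fun j => poissonize (compound_act pos) P (X 0) (c * (s j.+1 - s j)) j)
    (EFin \o \1_B) (iota 0 m) [tuple 0 | _ < n].
Proof.
move=> mB; set A := _ @^-1` B.
have mA : measurable A by rewrite -[A]setTI; exact: measurable_compound_tuple.
have mD j k : measurable (D j @^-1` [set k]).
  rewrite -[X in measurable X]setTI.
  have mDj : measurable_fun setT (D j).
    apply: (@measurable_nat_index _ _ T nat (N (s j.+1)) (fun k w => k - N (s j) w)%N) => // l.
    exact: (measurableT_comp (f := fun k => l - k)%N).
  exact: mDj.
have m1 : measurable_fun setT (EFin \o \1_B : n.-tuple R -> \bar R).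
  by apply/measurable_EFinP; exact: measurable_indic.
have ge0_1 (v : n.-tuple R) : (0 <= (EFin \o \1_B) v :> \bar R)%E by rewrite /= lee_fin.
have pre1 (V : T -> n.-tuple R) : measurable_fun setT V -> measurable (V @^-1` B).
  by move=> mV; rewrite -[X in measurable X]setTI; exact: mV.
rewrite (foldr_poissonize (measurable_compound_act pos) P (X 0)
  (fun j => c * (s j.+1 - s j))) //.
rewrite (prob_isum P (D := D) (iota 0 m)) //.
rewrite size_iota; apply: eq_isum => ls sz.
have szb : size (blocks (iota 0 m) ls) = sumn ls by rewrite -{1}sz size_blocks.
rewrite -prob_pattern // -[blocks _ _](mkseq_nth 0) szb.
rewrite -(expectation_walk (measurable_compound_act pos) X_iid) //.
set V := walk _ _ _ _ _.
have mV : measurable_fun setT V.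
  by apply: (measurable_walk (measurable_compound_act pos) _ _ _ (f := id)) => i.
have -> : (\int[P]_w (EFin \o \1_B) (V w) = P (V @^-1` B))%E.
  by rewrite -[V @^-1` B]setIT -integral_indic //; exact: pre1.
rewrite -prob_pattern_walk //.
(* The two events coincide for every path that starts at 0 and is nondecreasing, hence almost
   surely. *)
apply: probability_ae_eq.
- apply: measurableI => //; exact: measurable_map_eq.
- apply: measurableI; last exact: pre1.
  apply: fin_bigcap_measurable => // j _.
  rewrite -[X in measurable X]setTI.
  exact: (@measurable_increment _ T id (s j) (s j.+1) _ _ measurableT _ (measurable_set1 _)).
- apply: filterS2 (poisson_start N_poisson) (poisson_paths N_poisson) => w N0 [Nmono _].
  have incE j : (j < m)%N -> increment N (s j) (s j.+1) w = (D j w)%:R.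
    move=> jm; rewrite /increment /D natrB //.
    by apply: Nmono; [exact: s_ge0 (ltnW jm)|exact: ltW (s_lt jm)].
  have patE : [seq D j w | j <- iota 0 m] = ls <-> pattern ls w.
    split=> [<- j /= |pat].
      rewrite !inE mem_iota /= => jm.
      by rewrite incE // (nth_map 0) ?size_iota // nth_iota.
    apply: (@eq_from_nth _ 0); first by rewrite size_map size_iota.
    move=> j; rewrite size_map size_iota => jm.
    rewrite (nth_map 0) ?size_iota // nth_iota // add0n.
    have := pat j; rewrite /= !inE mem_iota /= => /(_ jm).
    by rewrite incE // => /eqP; rewrite eqr_nat => /eqP.
  have VE := compound_walk sz N0 Nmono.
  split=> [[Aw /patE pat]|[pat Vw]].
    by split => //; rewrite /preimage /= /V -VE.
  split; last exact/patE.
  by move: Vw; rewrite /preimage /= /V -VE.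
Qed.

End compound_law.

(** The grid is 0 followed by the distinct positive times in order; filtering out zero times keeps
    it strictly increasing. *)
Lemma increasing_grid (R : realType) (n : nat) (t : 'I_n -> R) :
  (forall i, 0 <= t i) ->
  exists (m : nat) (s : nat -> R) (pos : 'I_n -> nat),
    [/\ s 0 = 0, forall j, (j < m)%N -> s j < s j.+1,
        forall i, (pos i <= m)%N & forall i, t i = s (pos i)].
Proof.
move=> t_ge0.
pose r := sort <=%R (undup [seq t i | i <- enum 'I_n & 0 < t i]).
have r_gt0 x : x \in r -> 0 < x.
  rewrite mem_sort mem_undup => /mapP[i + ->].
  by rewrite mem_filter => /andP[].
have path_r : path <%R 0 r.
  rewrite path_sortedE; last exact: lt_trans.
  rewrite sort_lt_sorted undup_uniq andbT; apply/allP => x; exact: r_gt0.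
have mem_t i : t i \in 0 :: r.
  rewrite inE; have [//|ti0] := eqVneq (t i) 0.
  rewrite mem_sort mem_undup; apply/mapP; exists i => //.
  by rewrite mem_filter mem_enum lt_neqAle eq_sym ti0 t_ge0.
exists (size r), (nth 0 (0 :: r)), (fun i => index (t i) (0 :: r)); split => //.
- by move=> j jr; move/pathP : path_r => /(_ 0 j jr).
- by move=> i; have := mem_t i; rewrite -index_mem.
- by move=> i; rewrite nth_index.
Qed.

Unset Implicit Arguments.

Theorem lemma3p1 (R : realType) (lambda p0 : R)
    (d : measure_display) (T : measurableType d) (P : probability T R)
    (eta : nat -> {RV P >-> R}) (Nt : R -> {RV P >-> nat})
    (d' : measure_display) (T' : measurableType d') (P' : probability T' R)
    (Y : nat -> {RV P' >-> R}) (N : R -> {RV P' >-> nat})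
    (lambda_gt0 : 0 < lambda)
    (eta_iid : iid P eta)
    (eta_ge0 : forall i w, 0 <= eta i w)
    (p0_ge0 : 0 <= p0) (p0_lt1 : p0 < 1)
    (eta_p0 : P [set w | eta 0%N w = 0] = p0%:E)
    (Nt_poisson : poisson_process P lambda Nt)
    (Nt_eta_indep : independent_systems P
       (sigma_generated [set t : R | 0 <= t] (fun t => Nt t : T -> nat))
       (sigma_generated [set: nat] (fun i => eta i : T -> R)))
    (Y_iid : iid P' Y)
    (Y_gt0 : forall i w, 0 < Y i w)
    (Y_law : forall x : R, P' [set w | (Y 0%N w <= x)%R] =
       cond_prob P [set w | eta 0%N w <= x] [set w | 0 < eta 0%N w])
    (N_poisson : poisson_process P' (lambda * (1 - p0)) N)
    (N_Y_indep : independent_systems P'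
       (sigma_generated [set t : R | 0 <= t] (fun t => N t : T' -> nat))
       (sigma_generated [set: nat] (fun i => Y i : T' -> R))) :
  (forall x : R, 0 <= x ->
     (P' [set w | (Y 0%N w <= x)%R] =
        (P [set w | (eta 0%N w <= x)%R] - p0%:E) / (1 - p0)%:E)%E /\
     ('E_P'[fun w => expR (- x * Y 0%N w)] =
        ('E_P[fun w => expR (- x * eta 0%N w)] - p0%:E) / (1 - p0)%:E)%E) /\
  ((eta 0%N : T -> R) \in Lfun P 1%:E ->
     ('E_P'[Y 0%N] = 'E_P[eta 0%N] / (1 - p0)%:E)%E) /\
  ((eta 0%N : T -> R) \in Lfun P 2%:E ->
     (variance P' (Y 0%N) =
        variance P (eta 0%N) / (1 - p0)%:E -
        p0%:E * 'E_P[eta 0%N] ^+ 2 / ((1 - p0) ^+ 2)%:E)%E) /\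
  same_fdd P P' (compound_process Nt eta) (compound_process N Y).
Proof.
have Y_ge0 i w : 0 <= Y i w by exact: ltW.
split.
  move=> x x_ge0; split.
    exact: (conditional_cdf (eta_ge0 0) p0_ge0 p0_lt1 eta_p0 Y_law).
  exact: (conditional_laplace (eta_ge0 0) (Y_ge0 0) p0_ge0 p0_lt1 eta_p0 Y_law).
split.
  by move=> _; exact: (conditional_mean (eta_ge0 0) (Y_ge0 0) p0_ge0 p0_lt1 eta_p0 Y_law).
split.
  exact: (conditional_variance (eta_ge0 0) (Y_ge0 0) p0_ge0 p0_lt1 eta_p0 Y_law).
move=> n t t_ge0 B mB.
have [m [s [pos [s0 s_lt pos_le tE]]]] := increasing_grid t_ge0.
have -> : (fun w => [tuple compound_process Nt eta (t i) w | i < n]) =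
    (fun w => [tuple compound_process Nt eta (s (pos i)) w | i < n]).
  by apply/funext => w; apply: eq_from_tnth => i; rewrite !tnth_mktuple tE.
have -> : (fun w => [tuple compound_process N Y (t i) w | i < n]) =
    (fun w => [tuple compound_process N Y (s (pos i)) w | i < n]).
  by apply/funext => w; apply: eq_from_tnth => i; rewrite !tnth_mktuple tE.
(* Both laws become compositions of Poisson semigroups over the same grid, evaluated at the zero
   vector. *)
rewrite (compound_tuple_law eta_iid Nt_poisson Nt_eta_indep s0 s_lt pos_le mB).
rewrite (compound_tuple_law Y_iid N_poisson N_Y_indep s0 s_lt pos_le mB).
have mB1 : measurable_fun setT (EFin \o \1_B : n.-tuple R -> \bar R).
  by apply/measurable_EFinP; exact: measurable_indic.
have B1_ge0 (v : n.-tuple R) : (0 <= (EFin \o \1_B) v :> \bar R)%E by rewrite /= lee_fin.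
(* Thinning needs positive parameters, which the strictness of the grid provides. *)
have c_gt0 : all (fun j => 0 < lambda * (s j.+1 - s j)) (iota 0 m).
  apply/allP => j; rewrite mem_iota add0n => /andP[_ /s_lt slt].
  by rewrite mulr_gt0 // subr_gt0.
have e := foldr_poissonize_thinning (measurable_compound_act pos)
  (compound_act0 pos) p0_ge0 p0_lt1
  (conditional_law_mixture (eta_ge0 0) p0_ge0 p0_lt1 eta_p0 Y_law) mB1 B1_ge0 c_gt0.
apply: etrans (congr1 (fun g => g [tuple 0 | _ < n]) e) _.
apply: (congr1 (fun f => foldr f (EFin \o \1_B) (iota 0 m) [tuple 0 | _ < n])).
(* The thinned parameter of a cell is the parameter of [N] there, up to the order of the factors. *)
by apply/funext => j; rewrite mulrAC.
Qed.
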